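(* For any Hopf-zero classical normal form with $a_{01}\neq0$, there exists a Bogdanov–Takens singularity such that the flow generated by the planar reduced system associated with the Hopf-zero normal form is embedded into the flow of the Bogdanov–Takens singularity.
   Context: A Hopf-zero classical normal form is a formal system $$\dot x=\sum_{i+2j\ge2}a_{ij}x^i(y^2+z^2)^j,\quad \dot y=z+\sum_{i+2j\ge1}x^i(y^2+z^2)^j(b_{ij}y+c_{ij}z),\quad \dot z=-y+\sum_{i+2j\ge1}x^i(y^2+z^2)^j(b_{ij}z-c_{ij}y),$$ with real coefficients. In cylindrical coordinates $(x,\rho,\theta)$, $\rho=\sqrt{y^2+z^2}$, its planar reduced system is obtained by ignoring the phase ($\theta$) component: $$\dot x=\sum_{i+2j\ge2}a_{ij}x^i\rho^{2j},\qquad \dot\rho=\sum_{i+2j\ge1}b_{ij}x^i\rho^{2j+1},\qquad (x,\rho)\in\mathbb{R}\times\mathbb{R}^+,$$ where $\mathbb{R}^+$ denotes the nonnegative reals. Its vector field is denoted $\check v$. A Bogdanov–Takens singularity is a formal planar vector field, with coordinates $(\overline{x},\overline{y})\in\mathbb{R}^2$, of the form $w=-\overline{x}\frac{\partial}{\partial\overline{y}}+\text{h.o.t.}$ (h.o.t.: terms of degree at least two). All flows are flows of formal systems. The flow of $\check v$ is embedded into the flow of $w$ if there is a change of variables $\Phi:\mathbb{R}\times\mathbb{R}^+\to\mathbb{R}^2$, $\Phi(0)=0$, given by formal power series (polynomials), which is a homeomorphism onto its image and transforms $\check v$ into $w$, i.e. $D\Phi\cdot\check v=w\circ\Phi$ as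 an identity of formal power series. *)

(* Defs.v *)
(* The real line is an arbitrary [R : realType]. *)
From HB Require Import structures.
From mathcomp Require Import all_boot all_order all_algebra.
From mathcomp Require Import all_classical all_reals all_analysis.
From mathcomp Require Import ring.
Import Order.TTheory GRing.Theory Num.Theory numFieldNormedType.Exports.

Set Implicit Arguments.
Unset Strict Implicit.
Unset Printing Implicit Defensive.

Local Open Scope classical_set_scope.
Local Open Scope ring_scope.

(* Formal power series, given by their coefficients: [f i j] is the coefficient
   of x^i rho^j, and [F i k l] the coefficient of x^i y^k z^l. *)
Definition fps2 (R : Type) := nat -> nat -> R.
Definition fps3 (R : Type) := nat -> nat -> nat -> R.

(* Formal vector fields, as the pair (triple) of their components. *)
Definition field2 (R : Type) := (fps2 R * fps2 R)%type.
Definition field3 (R : Type) := (fps3 R * fps3 R * fps3 R)%type.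

Definition fps2_one (R : realType) : fps2 R :=
  fun i j => ((i == 0%N) && (j == 0%N))%:R.

Definition fps2_mul (R : realType) (f g : fps2 R) : fps2 R :=
  fun i j => \sum_(k < i.+1) \sum_(l < j.+1) f k l * g (i - k)%N (j - l)%N.

Definition fps2_exp (R : realType) (f : fps2 R) (n : nat) : fps2 R :=
  iter n (fps2_mul f) (fps2_one R).

(* The substitution w(f, g), meaningful when f and g have no constant term:
   f^k g^l then has no term of total degree less than k + l, so only k, l at
   most i + j contribute to the coefficient of bidegree (i, j). *)
Definition fps2_comp (R : realType) (w f g : fps2 R) : fps2 R :=
  fun i j => \sum_(k < (i + j).+1) \sum_(l < (i + j).+1)
    w k l * fps2_mul (fps2_exp f k) (fps2_exp g l) i j.

Definition fps2_d1 (R : realType) (f : fps2 R) : fps2 R :=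
  fun i j => i.+1%:R * f i.+1 j.
Definition fps2_d2 (R : realType) (f : fps2 R) : fps2 R :=
  fun i j => j.+1%:R * f i j.+1.

(* Df . v *)
Definition fps2_lie (R : realType) (v : field2 R) (f : fps2 R) : fps2 R :=
  fun i j => fps2_mul (fps2_d1 f) v.1 i j + fps2_mul (fps2_d2 f) v.2 i j.

(* Hopf-zero classical normal forms, given by the coefficients a_ij, b_ij and
   c_ij. Values outside the ranges i + 2j >= 2 (for a) and i + 2j >= 1 (for b
   and c) are ignored, through [coef_from]. *)
Record hopf_zero_cnf (R : realType) := HopfZeroCNF {
  hz_a : nat -> nat -> R;
  hz_b : nat -> nat -> R;
  hz_c : nat -> nat -> R }.

Definition coef_from (R : realType) (d : nat) (a : nat -> nat -> R) :
  nat -> nat -> R := fun i j => if (d <= i + 2 * j)%N then a i j else 0.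

(* \sum_(i + 2j >= d) a_ij x^i (y^2 + z^2)^j: by the binomial formula, y^k z^l
   occurs in (y^2 + z^2)^j only if k and l are even and k + l = 2j. *)
Definition rot_series (R : realType) (d : nat) (a : nat -> nat -> R) : fps3 R :=
  fun i k l => if odd k || odd l then 0
               else coef_from d a i (k + l)./2 *+ 'C((k + l)./2, k./2).

Definition fps3_y (R : realType) : fps3 R :=
  fun i k l => ([&& i == 0%N, k == 1%N & l == 0%N])%:R.
Definition fps3_z (R : realType) : fps3 R :=
  fun i k l => ([&& i == 0%N, k == 0%N & l == 1%N])%:R.
Definition fps3_muly (R : realType) (F : fps3 R) : fps3 R :=
  fun i k l => if k is k'.+1 then F i k' l else 0.
Definition fps3_mulz (R : realType) (F : fps3 R) : fps3 R :=
  fun i k l => if l is l'.+1 then F i k l' else 0.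

Definition hz_field (R : realType) (N : hopf_zero_cnf R) : field3 R :=
  (rot_series 2 (hz_a N),
   (fun i k l => fps3_z R i k l + fps3_muly (rot_series 1 (hz_b N)) i k l
                                + fps3_mulz (rot_series 1 (hz_c N)) i k l),
   (fun i k l => - fps3_y R i k l + fps3_mulz (rot_series 1 (hz_b N)) i k l
                                  - fps3_muly (rot_series 1 (hz_c N)) i k l)).

(* xdot = \sum_(i + 2j >= 2) a_ij x^i rho^(2j),
   rhodot = \sum_(i + 2j >= 1) b_ij x^i rho^(2j + 1). *)
Definition planar_reduced (R : realType) (N : hopf_zero_cnf R) : field2 R :=
  ((fun i n => if odd n then 0 else coef_from 2 (hz_a N) i n./2),
   (fun i n => if odd n then coef_from 1 (hz_b N) i n./2 else 0)).

(* F(x, rho cos t, rho sin t), as a series in x and rho. *)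
Definition polar (R : realType) (t : R) (F : fps3 R) : fps2 R :=
  fun i n => \sum_(k < n.+1) F i k (n - k)%N * (cos t ^+ k * sin t ^+ (n - k)).

(* The x and rho components of a field in the cylindrical coordinates
   (x, rho, t), at phase t: rhodot = cos t * ydot + sin t * zdot. *)
Definition cyl_field (R : realType) (t : R) (v : field3 R) : field2 R :=
  (polar t v.1.1,
   (fun i n => cos t * polar t v.1.2 i n + sin t * polar t v.2 i n)).

(* A formal field (\dot X, \dot Y) = (0, - X) + terms of degree at least 2. *)
Definition bogdanov_takens (R : realType) (w : field2 R) : Prop :=
  forall i j, (i + j <= 1)%N ->
    w.1 i j = 0 /\ w.2 i j = - ((i == 1%N) && (j == 0%N))%:R.

Definition homeo_onto_image (T U : topologicalType) (D : set T) (f : T -> U) :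
  Prop :=
  {within D, continuous f} /\
  exists2 g : U -> T, {within f @` D, continuous g} &
    forall x, D x -> g (f x) = x.

Definition half_plane (R : realType) : set (R * R) := [set u | 0 <= u.2].

(* Bivariate polynomials, with the outer variable for x: [p`_i`_j] is the
   coefficient of x^i rho^j, so [p.[x%:P].[rho]] is p(x, rho). *)
Definition poly2_fps (R : realType) (p : {poly {poly R}}) : fps2 R :=
  fun i j => p`_i`_j.

Definition poly2_eval (R : realType) (p : {poly {poly R}}) (x rho : R) : R :=
  p.[x%:P].[rho].

(* The components p and q of the change of variables are polynomials, so that
   it is an actual map on R x R^+. *)
Definition flow_embedded (R : realType) (v w : field2 R) : Prop :=
  exists p q : {poly {poly R}},
  [/\ (poly2_eval p 0 0 = 0) /\ (poly2_eval q 0 0 = 0),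
      homeo_onto_image (@half_plane R)
        (fun u : R * R => (poly2_eval p u.1 u.2, poly2_eval q u.1 u.2)),
      (forall i j, fps2_lie v (poly2_fps p) i j =
                   fps2_comp w.1 (poly2_fps p) (poly2_fps q) i j)
    & (forall i j, fps2_lie v (poly2_fps q) i j =
                   fps2_comp w.2 (poly2_fps p) (poly2_fps q) i j)].

(* The phase decouples: in cylindrical coordinates, the x and rho components of
   a classical normal form do not depend on t, and are [planar_reduced]. *)

Lemma sum_even_terms (R : realType) (G : nat -> R) (m : nat) :
  (forall k, odd k -> G k = 0) ->
  \sum_(k < (m.*2).+1) G k = \sum_(q < m.+1) G q.*2.
Proof.
move=> G0; elim: m => [|m IHm]; first by rewrite !big_ord_recl !big_ord0.
rewrite doubleS big_ord_recr big_ord_recr /= IHm [RHS]big_ord_recr /=.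
by rewrite (G0 m.*2.+1) ?addr0 //= odd_double.
Qed.

Lemma polar_rot (R : realType) (t : R) d (a : nat -> nat -> R) i n :
  polar t (rot_series d a) i n = if odd n then 0 else coef_from d a i n./2.
Proof.
rewrite /polar /rot_series.
have kn (k : 'I_n.+1) : (k <= n)%N by rewrite -ltnS.
case: ifPn => [on|en].
  rewrite big1 // => k _.
  have -> : odd k || odd (n - k) by rewrite oddB // on; case: (odd k).
  by rewrite mul0r.
have -> : n = n./2.*2 by rewrite -[LHS]odd_double_half (negbTE en).
set m := n./2; rewrite doubleK.
rewrite (sum_even_terms (G := fun k => (if odd k || odd (m.*2 - k) then 0
   else coef_from d a i (k + (m.*2 - k))./2 *+ 'C((k + (m.*2 - k))./2, k./2))
   * (cos t ^+ k * sin t ^+ (m.*2 - k)))); last first.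
  by move=> k ->; rewrite mul0r.
transitivity (coef_from d a i m * (sin t ^+ 2 + cos t ^+ 2) ^+ m); last first.
  by rewrite addrC cos2Dsin2 expr1n mulr1.
rewrite exprDn big_distrr /=; apply: eq_bigr => q _.
have qm : (q <= m)%N by rewrite -ltnS.
rewrite -doubleB !odd_double /= -doubleD subnKC // !doubleK -!muln2 !(mulnC _ 2%N).
by rewrite -!exprM mulrnAl mulrnAr (mulrC (sin t ^+ _)).
Qed.

Lemma polar_muly (R : realType) (t : R) (F : fps3 R) i n :
  polar t (fps3_muly F) i n = if n is m.+1 then cos t * polar t F i m else 0.
Proof.
rewrite /polar big_ord_recl /= mul0r add0r.
case: n => [|n]; first by rewrite big_ord0.
rewrite big_distrr /=; apply: eq_bigr => k _.
by rewrite /bump /= add1n subSS exprS; ring.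
Qed.

Lemma polar_mulz (R : realType) (t : R) (F : fps3 R) i n :
  polar t (fps3_mulz F) i n = if n is m.+1 then sin t * polar t F i m else 0.
Proof.
rewrite /polar big_ord_recr /= subnn /= mul0r addr0.
case: n => [|n]; first by rewrite big_ord0.
rewrite big_distrr /=; apply: eq_bigr => k _.
have kn : (k <= n)%N by rewrite -ltnS.
rewrite subSn // exprS /=; ring.
Qed.

Lemma polarD (R : realType) (t : R) (F G : fps3 R) i n :
  polar t (fun i k l => F i k l + G i k l) i n = polar t F i n + polar t G i n.
Proof. by rewrite -big_split; apply: eq_bigr => k _; rewrite /= mulrDl. Qed.

Lemma polarN (R : realType) (t : R) (F : fps3 R) i n :
  polar t (fun i k l => - F i k l) i n = - polar t F i n.
Proof.
by rewrite -[RHS]mulN1r big_distrr; apply: eq_bigr => k _ /=; ring.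
Qed.

Definition fps3_one (R : realType) : fps3 R :=
  fun i k l => ([&& i == 0%N, k == 0%N & l == 0%N])%:R.

Lemma fps3_yE (R : realType) : fps3_y R = fps3_muly (fps3_one R).
Proof.
apply/funext => i; apply/funext => -[|k]; apply/funext => l //.
by rewrite /fps3_y andbF.
Qed.

Lemma fps3_zE (R : realType) : fps3_z R = fps3_mulz (fps3_one R).
Proof.
apply/funext => i; apply/funext => k; apply/funext => -[|l] //.
by rewrite /fps3_z !andbF.
Qed.

Theorem cyl_field_planar_reduced (R : realType) (N : hopf_zero_cnf R) (t : R) :
  cyl_field t (hz_field N) = planar_reduced N.
Proof.
congr pair; apply/funext => i; apply/funext => n /=; first exact: polar_rot.
rewrite !polarD !polarN fps3_yE fps3_zE !polar_muly !polar_mulz.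
case: n => [|n] /=; first by rewrite oppr0 !addr0 !mulr0 addr0.
rewrite !polar_rot.
rewrite uphalf_half.
have cs := cos2Dsin2 t.
set B := if _ then _ else coef_from 1 (hz_b N) _ _.
transitivity ((cos t ^+ 2 + sin t ^+ 2) * B); first by ring.
by rewrite cs mul1r /B; case: ifP.
Qed.

(* Main.v *)
Require Import Defs.
From mathcomp Require Import all_boot all_order all_algebra.
From mathcomp Require Import all_classical all_reals all_analysis.
Import GRing.Theory numFieldNormedType.Exports.
Local Open Scope ring_scope.

(** The planar reduced system is even in rho, so that with r = rho^2 it reads
      xdot = a_01 r + O(2),   rdot = 2 r \sum b_ij x^i r^j = O(2).
    In the coordinates (x, r) its linear part is thus the nilpotent Jordan block
    xdot = a_01 r, rdot = 0, and a_01 <> 0 lets us normalize it by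
      (X, Y) = (- a_01 rho^2, x),
    for which Ydot = - X + O(2) and Xdot = O(2): a Bogdanov-Takens field [w],
    whose coefficients [bt_of_planar] are obtained by substituting x = Y and
    r = - X / a_01. This (X, Y) is a quadratic polynomial map, which folds the
    plane along the x-axis; on the half plane rho >= 0 it is injective, with
    continuous inverse (X, Y) |-> (Y, sqrt (- X / a_01)).

    The conjugacy is an identity between coefficients. Both components of the
    change of variables are monomials, so multiplying by their derivatives
    shifts indices ([fps2_mul_mon]), and substituting them in a series selects a
    single coefficient ([fps2_comp_mon]). *)

Definition fps2_mon (R : realType) (c : R) (a b : nat) : fps2 R :=
  fun i j => c *+ ((i == a) && (j == b)).

Lemma fps2_mul_mon (R : realType) (c : R) a b (g : fps2 R) i j :
  fps2_mul (fps2_mon R c a b) g i j =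
  if (a <= i)%N && (b <= j)%N then c * g (i - a)%N (j - b)%N else 0.
Proof.
rewrite /fps2_mul /fps2_mon.
case: ifPn => [/andP[ai bj]|nab].
  rewrite (bigD1 (Ordinal (ai : a < i.+1)%N)) //= (bigD1 (Ordinal (bj : b < j.+1)%N)) //=.
  rewrite !eqxx mulr1n big1 ?addr0 => [|l nl]; last first.
    by rewrite -val_eqE /= in nl; rewrite (negbTE nl) mulr0n mul0r.
  rewrite big1 ?addr0 // => k nk; rewrite big1 // => l _.
  by rewrite -val_eqE /= in nk; rewrite (negbTE nk) mulr0n mul0r.
rewrite big1 // => k _; rewrite big1 // => l _.
case: eqP => [ka|_]; last by rewrite mulr0n mul0r.
case: eqP => [lb|_]; last by rewrite mulr0n mul0r.
by move: nab; rewrite -ka -lb (leq_ord k) (leq_ord l).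
Qed.

Lemma fps2_mul_mon_mon (R : realType) (c d : R) a b a' b' :
  fps2_mul (fps2_mon R c a b) (fps2_mon R d a' b') =
  fps2_mon R (c * d) (a + a') (b + b').
Proof.
apply/funext => i; apply/funext => j; rewrite fps2_mul_mon /fps2_mon.
have shift m n p : (m <= n)%N -> ((n - m)%N == p) = (n == (m + p)%N).
  by move=> mn; rewrite -(eqn_add2l m) subnKC.
case: ifPn => [/andP[ai bj]|nab]; first by rewrite !shift // mulrnAr.
case: eqP => [ia|//]; case: eqP => [jb|//].
by move: nab; rewrite ia jb !leq_addr.
Qed.

Lemma fps2_exp_mon (R : realType) (c : R) a b n :
  fps2_exp (fps2_mon R c a b) n = fps2_mon R (c ^+ n) (n * a) (n * b).
Proof.
elim: n => [|n IHn]; last by rewrite exprS !mulSn -fps2_mul_mon_mon -IHn.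
by apply/funext => i; apply/funext => j.
Qed.

(** The products c^k rho^(2k) x^l have pairwise distinct bidegrees: only
    k = j / 2 and l = i reach (i, j), and j has to be even. *)
Lemma fps2_comp_mon (R : realType) (c : R) (w : fps2 R) i j :
  fps2_comp w (fps2_mon R c 0 2) (fps2_mon R 1 1 0) i j =
  if odd j then 0 else w j./2 i * c ^+ j./2.
Proof.
rewrite /fps2_comp.
under eq_bigr => k _ do under eq_bigr => l _ do
  rewrite !fps2_exp_mon fps2_mul_mon_mon expr1n mulr1 /fps2_mon
    muln0 add0n muln1 muln0 addn0 muln2.
case: ifPn => [oj|ej].
  rewrite big1 // => k _; rewrite big1 // => l _.
  case: (j =P (k : nat).*2) => [jk|_]; last by rewrite andbF mulr0n mulr0.
  by have := odd_double k; rewrite -jk oj.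
have jE : j = j./2.*2 by rewrite -[LHS]odd_double_half (negbTE ej).
have lej : (j./2 < (i + j).+1)%N.
  by rewrite ltnS {2}jE -addnn addnA leq_addl.
have lei : (i < (i + j).+1)%N by rewrite ltnS leq_addr.
rewrite (bigD1 (Ordinal lej)) //= (bigD1 (Ordinal lei)) //= -jE !eqxx mulr1n.
rewrite big1 ?addr0 => [|l nl]; last first.
  by rewrite -val_eqE /= eq_sym in nl; rewrite (negbTE nl) mulr0n mulr0.
rewrite big1 ?addr0 // => k nk; rewrite big1 // => l _.
case: (j =P (k : nat).*2) => [jk|_]; last by rewrite andbF mulr0n mulr0.
by move/(congr1 half): jk; rewrite doubleK => jk; rewrite -val_eqE /= jk eqxx in nk.
Qed.

(** The planar reduced system in the coordinates (X, Y) = (c rho^2, x): the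
    exponent of X comes first, while x, that is Y, comes first in the
    coefficients of the normal form. The shift in the first component is the
    factor X of Xdot = 2 X \sum b_ij Y^i (X / c)^j. *)
Definition bt_of_planar (R : realType) (c : R) (N : hopf_zero_cnf R) : field2 R :=
  ((fun k l => if k is k'.+1 then 2 * coef_from 1 (hz_b N) l k' / c ^+ k' else 0),
   (fun k l => coef_from 2 (hz_a N) l k / c ^+ k)).

(** The coefficient of X in Ydot is a_01 / c, which is where the choice
    c = - a_01 comes from. *)
Lemma bt_of_planar_bogdanov_takens (R : realType) (N : hopf_zero_cnf R) :
  hz_a N 0%N 1%N != 0 -> bogdanov_takens (bt_of_planar R (- hz_a N 0%N 1%N) N).
Proof.
move=> a0 [|[|k]] [|[|l]] //= _; rewrite /coef_from /= ?mulr0 ?mul0r ?oppr0 //.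
by split=> //; rewrite expr1 invrN mulrN divff.
Qed.

(** The parities match: rhodot is odd in rho, so 2 c rho rhodot is even in rho,
    hence a series in x and rho^2. *)
Lemma fps2_lie_rho2 (R : realType) (c : R) (N : hopf_zero_cnf R) i j : c != 0 ->
  fps2_lie (planar_reduced N) (fps2_mon R c 0 2) i j =
  fps2_comp (bt_of_planar R c N).1 (fps2_mon R c 0 2) (fps2_mon R 1 1 0) i j.
Proof.
move=> c0; rewrite fps2_comp_mon /fps2_lie.
have -> : fps2_d1 (fps2_mon R c 0 2) = fps2_mon R 0 0 0.
  apply/funext => k; apply/funext => l.
  by rewrite /fps2_d1 /fps2_mon /= mulr0n mulr0 mul0rn.
have -> : fps2_d2 (fps2_mon R c 0 2) = fps2_mon R (2 * c) 0 1.
  apply/funext => k; apply/funext => l; rewrite /fps2_d2 /fps2_mon eqSS.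
  by case: (l =P 1%N) => [->|_]; rewrite ?andbF ?mulr0n ?mulr0 // mulrnAr.
rewrite !fps2_mul_mon /= mul0r add0r subn0.
case: j => [|j] /=; first by rewrite mul0r.
rewrite subn1 /=; case: ifPn => [oj|ej]; last by rewrite mulr0.
rewrite uphalf_half oj add1n exprSr.
by rewrite mulrA mulfVK ?expf_neq0 // mulrAC.
Qed.

Lemma fps2_lie_x (R : realType) (c : R) (N : hopf_zero_cnf R) i j : c != 0 ->
  fps2_lie (planar_reduced N) (fps2_mon R 1 1 0) i j =
  fps2_comp (bt_of_planar R c N).2 (fps2_mon R c 0 2) (fps2_mon R 1 1 0) i j.
Proof.
move=> c0; rewrite fps2_comp_mon /fps2_lie.
have -> : fps2_d1 (fps2_mon R 1 1 0) = fps2_mon R 1 0 0.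
  apply/funext => k; apply/funext => l; rewrite /fps2_d1 /fps2_mon eqSS.
  by case: (k =P 0%N) => [->|_]; rewrite ?mulr0n ?mulr0 // mul1r.
have -> : fps2_d2 (fps2_mon R 1 1 0) = fps2_mon R 0 0 0.
  apply/funext => k; apply/funext => l.
  by rewrite /fps2_d2 /fps2_mon andbF mulr0n mulr0 mul0rn.
rewrite !fps2_mul_mon /= mul0r addr0 mul1r !subn0.
by case: ifP => // _; rewrite mulfVK // expf_neq0.
Qed.

Lemma continuous_pair (T U V : topologicalType) (f : T -> U) (g : T -> V) :
  continuous f -> continuous g -> continuous (fun x => (f x, g x)).
Proof. by move=> cf cg x; exact: (cvg_pair (cf x) (cg x)). Qed.

(** [Num.sqrt] extends the square root by 0 to negative numbers, so the inverse
    is continuous on the whole plane, and not only on the image. *)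
Lemma fold_homeo (R : realType) (c : R) : c != 0 ->
  homeo_onto_image (@half_plane R) (fun u : R * R => (c * u.2 ^+ 2, u.1)).
Proof.
have fst_cont : continuous (@fst R R) by move=> u; exact: cvg_fst.
have snd_cont : continuous (@snd R R) by move=> u; exact: cvg_snd.
move=> c0; split.
  apply: continuous_subspaceT; apply: continuous_pair => // u.
  apply: (cvgM (cvg_cst _)); apply: (continuous_comp (g := fun r : R => r ^+ 2)) => /=; first exact: snd_cont.
  exact: exprn_continuous.
exists (fun u : R * R => (u.2, Num.sqrt (u.1 / c))); last first.
  move=> [x rho] /= rho0; congr pair.
  by rewrite mulrAC divff // mul1r Num.Theory.sqrtr_sqr Num.Theory.ger0_norm.
apply: continuous_subspaceT; apply: continuous_pair => // u.
apply: (continuous_comp (f := fun v : R * R => v.1 / c)); last exact: sqrt_continuous.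
exact: (cvgM (fst_cont u) (cvg_cst _)).
Qed.

Lemma poly2_fps_rho2 (R : realType) (c : R) :
  poly2_fps (c *: 'X^2)%:P = fps2_mon R c 0 2.
Proof.
apply/funext => i; apply/funext => j; rewrite /poly2_fps /fps2_mon coefC.
by case: i => [|i] /=; rewrite ?coef0 // coefZ coefXn mulr_natr.
Qed.

Lemma poly2_fps_x (R : realType) : poly2_fps 'X = fps2_mon R 1 1 0.
Proof.
apply/funext => i; apply/funext => j; rewrite /poly2_fps /fps2_mon coefX.
by case: (i == 1%N); rewrite ?coef0 // coef1.
Qed.

Theorem theorem2p7 (R : realType) (N : hopf_zero_cnf R)
    (ha01 : hz_a N 0%N 1%N != 0) :
  exists w : field2 R,
    bogdanov_takens w /\ flow_embedded (planar_reduced N) w.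
Proof.
pose c := - hz_a N 0%N 1%N.
have c0 : c != 0 by rewrite oppr_eq0.
exists (bt_of_planar R c N); split; first exact: bt_of_planar_bogdanov_takens.
exists (c *: 'X^2)%:P, 'X; rewrite poly2_fps_rho2 poly2_fps_x.
have evp x rho : poly2_eval (c *: 'X^2)%:P x rho = c * rho ^+ 2.
  by rewrite /poly2_eval hornerC hornerZ hornerXn.
have evq x rho : poly2_eval 'X x rho = x :> R.
  by rewrite /poly2_eval hornerX hornerC.
split; first by rewrite evp evq expr0n mulr0.
- by under eq_fun do rewrite evp evq; exact: fold_homeo.
- by move=> i j; exact: fps2_lie_rho2.
- by move=> i j; exact: fps2_lie_x.
Qed.
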